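(* Let $\mathbb{F}$ be a field and let $\Omega$ be the quiver with vertices $x_n$ ($n\in\mathbb{Z}$) and arrows $a_n:x_{n+1}\to x_n$ for $n\ge 0$ and $a_n:x_n\to x_{n+1}$ for $n<0$ (so all arrows point towards $x_0$). Let $V$ be the representation of $\Omega$ over $\mathbb{F}$ with $V_n=0$ at $x_n$ for all $n<0$, and, for $n\ge 0$, $V_n$ at $x_n$ the vector space of all sequences $(b_0,b_1,\ldots)$ with entries in $\mathbb{F}$ such that $b_m=0$ for all $m<n$; for $n\ge 0$ the map $f_n:V_{n+1}\to V_n$ attached to $a_n$ is the inclusion (and the maps attached to $a_n$ for $n<0$ are zero). Then $V$ is not Krull-Schmidt.
   Context: A representation of a quiver over $\mathbb{F}$ assigns an $\mathbb{F}$-vector space to each vertex and a linear map $V_{s(e)}\to V_{t(e)}$ to each arrow $e$ with source $s(e)$ and target $t(e)$. A representation is indecomposable if it is nonzero and is not a direct sum of two proper nonzero subrepresentations. It is Krull-Schmidt if it is a direct sum of indecomposable subrepresentations. *)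

(* Defs.v *)
From HB Require Import structures.
From mathcomp Require Import all_boot all_order all_algebra.
From mathcomp Require Import mathcomp_extra boolp classical_sets functions.
From mathcomp Require Import cardinality fsbigop.

Set Implicit Arguments.
Unset Strict Implicit.
Unset Printing Implicit Defensive.

Import GRing.Theory.
Local Open Scope classical_set_scope.
Local Open Scope ring_scope.

(* A (possibly infinite-dimensional) subspace U of M, i.e. a boolean predicate
   closed under the module operations, turned into an lmodType. *)
Section SubspaceType.
Variables (F : fieldType) (M : lmodType F) (U : submodClosed M).

Record subspace_type :=
  SubspaceType { subspace_val : M; subspace_valP : subspace_val \in U }.

HB.instance Definition _ := [isSub for subspace_val].
HB.instance Definition _ := [Choice of subspace_type by <:].
HB.instance Definition _ := [SubChoice_isSubLmodule of subspace_type by <:].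

End SubspaceType.

Section RestrictLinear.
Variables (F : fieldType) (M N : lmodType F) (f : {linear M -> N}).
Variables (U : submodClosed M) (U' : submodClosed N).
Hypothesis fUU' : forall v, v \in U -> f v \in U'.

Definition restrict_linear (u : subspace_type U) : subspace_type U' :=
  SubspaceType (fUU' (subspace_valP u)).

Lemma restrict_linear_is_linear : linear restrict_linear.
Proof. by move=> c u v; apply: val_inj; rewrite /= linearP. Qed.

HB.instance Definition _ := GRing.isLinear.Build F (subspace_type U)
  (subspace_type U') _ restrict_linear restrict_linear_is_linear.

End RestrictLinear.

Record quiver := Quiver {
  vertex : Type;
  arrow : Type;
  source : arrow -> vertex;
  target : arrow -> vertex }.

Record representation (F : fieldType) (Q : quiver) := Representation {
  rep_space : vertex Q -> lmodType F;
  rep_map : forall a : arrow Q,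
    {linear rep_space (source a) -> rep_space (target a)} }.

Record subrepresentation (F : fieldType) (Q : quiver)
    (V : representation F Q) := Subrepresentation {
  subrep_at : forall x : vertex Q, submodClosed (rep_space V x);
  subrep_stable : forall (a : arrow Q) (v : rep_space V (source a)),
    v \in subrep_at (source a) -> rep_map V a v \in subrep_at (target a) }.

Section Representations.
Variables (F : fieldType) (Q : quiver).

Definition rep_of_subrep (V : representation F Q) (W : subrepresentation V) :
    representation F Q :=
  @Representation F Q (fun x => subspace_type (subrep_at W x))
    (fun a => restrict_linear (@subrep_stable F Q V W a)).

Definition nonzero_rep (V : representation F Q) : Prop :=
  exists (x : vertex Q) (v : rep_space V x), v != 0.

Definition proper_subrep (V : representation F Q) (W : subrepresentation V) :
    Prop :=
  exists (x : vertex Q) (v : rep_space V x), v \notin subrep_at W x.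

(* V is the internal direct sum of the family W: at each vertex, every vector
   is in exactly one way a finitely supported sum of vectors of the W i. *)
Definition is_direct_sum (V : representation F Q) (I : choiceType)
    (W : I -> subrepresentation V) : Prop :=
  forall (x : vertex Q) (v : rep_space V x),
    exists! w : I -> rep_space V x,
      [/\ forall i, w i \in subrep_at (W i) x,
          finite_set [set i | w i != 0] &
          v = \sum_(i \in [set: I]) w i].

Definition indecomposable (V : representation F Q) : Prop :=
  nonzero_rep V /\
  ~ exists W : bool -> subrepresentation V,
      (forall i, nonzero_rep (rep_of_subrep (W i)) /\ proper_subrep (W i)) /\
      is_direct_sum W.

Definition krull_schmidt (V : representation F Q) : Prop :=
  exists (I : choiceType) (W : I -> subrepresentation V),
    (forall i, indecomposable (rep_of_subrep (W i))) /\ is_direct_sum W.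

End Representations.

(* Vertices x_n and arrows a_n are both indexed by n : int; recall that
   Negz m is the integer -(m + 1). *)
Definition Omega_source (n : int) : int :=
  match n with Posz m => Posz m.+1 | Negz m => Negz m end.

Definition Omega_target (n : int) : int :=
  match n with Posz m => Posz m | Negz m => Negz m + 1 end.

Definition Omega : quiver := Quiver Omega_source Omega_target.

Section TailRepresentation.
Variable F : fieldType.

Definition tail_pred (n : nat) : {pred nat -> F^o} :=
  fun b => `[< forall m : nat, (m < n)%N -> b m = 0 >].

Lemma tail_submod_closed (n : nat) : submod_closed (tail_pred n).
Proof.
split=> [|c b b' /asboolP hb /asboolP hb']; apply/asboolP => m mn //.
rewrite -[LHS]/(c *: b m + b' m) hb // hb' //; by rewrite scaler0 addr0.
Qed.

HB.instance Definition _ (n : nat) :=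
  GRing.isSubmodClosed.Build F (nat -> F^o) (tail_pred n) (tail_submod_closed n).

Definition tail_subspace (n : nat) : submodClosed (nat -> F^o) := tail_pred n.

Lemma tail_incl (n : nat) (b : nat -> F^o) :
  b \in tail_subspace n.+1 -> idfun b \in tail_subspace n.
Proof. by move=> /asboolP hb; apply/asboolP => m /ltnW; exact: hb. Qed.

Definition tail_space (n : vertex Omega) : lmodType F :=
  match n with
  | Posz m => subspace_type (tail_subspace m)
  | Negz _ => 'rV[F]_0
  end.

Definition tail_map (n : arrow Omega) :
    {linear tail_space (source n) -> tail_space (target n)} :=
  match n with
  | Posz m => restrict_linear (@tail_incl m)
  | Negz _ => \0
  end.

Definition tail_rep : representation F Omega := Representation tail_map.

End TailRepresentation.

(* Main.v *)
Require Import Defs.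
From HB Require Import structures.
From mathcomp Require Import all_boot all_order all_algebra.
From mathcomp Require Import finmap.
From mathcomp Require Import boolp classical_sets functions cardinality fsbigop.

Set Implicit Arguments.
Unset Strict Implicit.
Unset Printing Implicit Defensive.

Import GRing.Theory.
Local Open Scope classical_set_scope.
Local Open Scope ring_scope.

(** Write V as a descending chain of sequence spaces V_0, V_1, ..., where V_n
    consists of the sequences vanishing before n, and suppose that V is the
    direct sum of indecomposable subrepresentations W_i.

    An indecomposable summand has at most one leading position.  Indeed, let w
    in W_i(n) have w_n <> 0.  Subtracting multiples of w, one can kill the n-th
    coordinate of any vector of W_i: the map u |-> (u_n / w_n) w is an
    idempotent endomorphism of W_i (at x_k with k > n it vanishes, because
    there u_n = 0).  An indecomposable representation has no idempotents but 0
    and 1 ([indecomposable_idempotent]); this one fixes w and kills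
    W_i(n+1), so W_i(n+1) = 0 ([indecomposable_subrep_leading]).

    Conversely every position n is the leading position of some summand: the
    n-th unit vector lies in V_n, so one of its components, in some W_(i_n)(n),
    has a nonzero n-th coordinate ([leading_component]).  Call it w_n.  Since
    W_(i_n)(n+1) = 0, the indices i_n are pairwise distinct.

    Finally, the infinite sum v of all the w_n is a well-defined sequence, as
    only w_0, ..., w_m contribute to its m-th coordinate.  For every n, the
    vector v - (w_0 + ... + w_n) lies in V_(n+1), hence has component 0 in
    W_(i_n), as W_(i_n)(n+1) = 0.  So the component of v in W_(i_n) is that of
    w_0 + ... + w_n, namely w_n, which is nonzero.  Thus v has infinitely many
    nonzero components, which is absurd. *)

(** * Finitely supported sums *)

Section FinitelySupportedSums.
Variables (I : choiceType) (M N : zmodType).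

Lemma additive_fsum (f : {additive M -> N}) (w : I -> M) :
  finite_set [set i | w i != 0] ->
  f (\sum_(i \in [set: I]) w i) = \sum_(i \in [set: I]) f (w i).
Proof.
move=> fin_w; pose A := fset_set [set i | w i != 0].
have w0 i : i \notin A -> w i = 0.
  by rewrite in_fset_set // notin_setE /= => /negP; rewrite negbK => /eqP.
rewrite (@fsbigTE _ _ _ _ A) // raddf_sum (@fsbigTE _ _ _ _ A) // => i /w0 ->.
exact: raddf0.
Qed.

Lemma fsumD (w w' : I -> M) :
  finite_set [set i | w i != 0] -> finite_set [set i | w' i != 0] ->
  \sum_(i \in [set: I]) (w i + w' i) =
  \sum_(i \in [set: I]) w i + \sum_(i \in [set: I]) w' i.
Proof.
move=> fin_w fin_w'.
pose A := fset_set ([set i | w i != 0] `|` [set i | w' i != 0]).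
have w0 i : i \notin A -> w i = 0 /\ w' i = 0.
  rewrite in_fset_set ?finite_setU // notin_setE => /not_orP[/= wi w'i].
  by split; apply/eqP; [move/negP/negPn: wi | move/negP/negPn: w'i].
rewrite !(@fsbigTE _ _ _ _ A) ?big_split // => i /w0[wi w'i] //.
by rewrite wi w'i addr0.
Qed.

Lemma fsum_single (j : I) (v : M) :
  \sum_(i \in [set: I]) (if i == j then v else 0) = v.
Proof.
rewrite (@fsbigTE _ _ _ _ [fset j]%fset) => [|i]; last first.
  by rewrite inE => /negPf ->.
by rewrite big_seq_fset1 eqxx.
Qed.

End FinitelySupportedSums.

(** * Kernels, endomorphisms and idempotents *)

Section KernelPred.
Variables (F : fieldType) (M N : lmodType F) (f : {linear M -> N}).

Definition ker_pred : {pred M} := fun v => f v == 0.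

Lemma ker_submod_closed : submod_closed ker_pred.
Proof.
split=> [|c u v]; rewrite !unfold_in ?raddf0 // => /eqP fu /eqP fv.
by rewrite linearP fu fv scaler0 addr0.
Qed.

HB.instance Definition _ :=
  GRing.isSubmodClosed.Build F M ker_pred ker_submod_closed.

Definition ker_submod : submodClosed M := ker_pred.

Lemma ker_submodE v : (v \in ker_submod) = (f v == 0).
Proof. by []. Qed.

End KernelPred.

Section Idempotents.
Variables (F : fieldType) (Q : quiver) (V : representation F Q).

Definition endomorphism
    (f : forall x, {linear rep_space V x -> rep_space V x}) :=
  forall a v, f _ (rep_map V a v) = rep_map V a (f _ v).

Lemma ker_stable f : endomorphism f ->
  forall a v, v \in ker_submod (f (source a)) ->
    rep_map V a v \in ker_submod (f (target a)).
Proof.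
by move=> ef a v; rewrite !ker_submodE ef => /eqP ->; rewrite raddf0.
Qed.

Definition ker_subrep f (ef : endomorphism f) : subrepresentation V :=
  @Subrepresentation F Q V (fun x => ker_submod (f x)) (ker_stable ef).

Definition complement
    (f : forall x, {linear rep_space V x -> rep_space V x}) x :
  {linear rep_space V x -> rep_space V x} := idfun \- f x.

Lemma complement_endo f : endomorphism f -> endomorphism (complement f).
Proof. by move=> ef a v; rewrite /= ef raddfB. Qed.

Lemma complementE f x v : complement f x v = v - f x v.
Proof. by []. Qed.

(** The image of an idempotent is the kernel of the complementary idempotent, so
    both summands of V = im f + ker f are kernels. *)
Definition im_ker f (ef : endomorphism f) (b : bool) : subrepresentation V :=
  if b then ker_subrep (complement_endo ef) else ker_subrep ef.

Lemma im_kerE f (ef : endomorphism f) b x v :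
  (v \in subrep_at (im_ker ef b) x) = (f x v == if b then v else 0).
Proof.
case: b; rewrite /im_ker /ker_subrep [LHS]ker_submodE //.
by rewrite complementE subr_eq0 eq_sym.
Qed.

(** The decomposition is v = f v + (v - f v); it is the only one, since applying
    f to v = v1 + v0 with f v1 = v1 and f v0 = 0 gives f v = v1. *)
Lemma im_ker_direct_sum f (ef : endomorphism f) :
  (forall x v, f x (f x v) = f x v) -> is_direct_sum (im_ker ef).
Proof.
move=> ff x v.
have fin_bool (P : set bool) : finite_set P.
  exact: finite_finset.
have fsum_bool (w : bool -> rep_space V x) :
    \sum_(i \in [set: bool]) w i = w true + w false.
  rewrite (fsbigE [:: true; false]) //=.
    by rewrite !big_cons big_nil !in_setT addr0.
  by case; rewrite !inE.
exists (fun b => if b then f x v else v - f x v); split.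
  split=> //; last by rewrite fsum_bool addrC subrK.
  by case; rewrite im_kerE ?ff // raddfB /= ff subrr.
move=> w [Ww _]; rewrite fsum_bool => vE.
have /eqP f1 : f x (w true) == w true by rewrite -(im_kerE ef true).
have /eqP f0 : f x (w false) == 0 by rewrite -(im_kerE ef false).
have fv : f x v = w true by rewrite vE raddfD /= f1 f0 addr0.
by apply/funext; case=> //; rewrite fv vE addrC addKr.
Qed.

(** If f v <> 0 and f u <> u, then f v and u - f u witness that the image and
    the kernel of f are both nonzero, and v and u that they are both proper. *)
Lemma indecomposable_idempotent f :
    indecomposable V -> endomorphism f ->
    (forall x v, f x (f x v) = f x v) ->
  (forall x v, f x v = 0) \/ (forall x v, f x v = v).
Proof.
move=> [_ indV] ef ff; apply: contrapT => /not_orP[].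
move=> /existsNP[x /existsNP[v /eqP fv]] /existsNP[y /existsNP[u /eqP fu]].
have fvT : f x v \in subrep_at (im_ker ef true) x by rewrite im_kerE ff.
have fuF : u - f y u \in subrep_at (im_ker ef false) y.
  by rewrite im_kerE raddfB /= ff subrr.
apply: indV; exists (im_ker ef); split; last exact: im_ker_direct_sum.
case; split.
- by exists x, (SubspaceType fvT); rewrite -val_eqE.
- by exists y, u; rewrite im_kerE.
- by exists y, (SubspaceType fuF); rewrite -val_eqE /= subr_eq0 eq_sym.
- by exists x, v; rewrite im_kerE.
Qed.

End Idempotents.

(** * Components with respect to a direct sum *)

Section Components.
Variables (F : fieldType) (Q : quiver) (V : representation F Q).
Variables (I : choiceType) (W : I -> subrepresentation V).
Hypothesis dsW : is_direct_sum W.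

Definition component (i : I) (x : vertex Q) (v : rep_space V x) :
  rep_space V x := projT1 (cid (dsW v)) i.

Lemma componentP x (v : rep_space V x) :
  [/\ forall i, component i v \in subrep_at (W i) x,
      finite_set [set i | component i v != 0] &
      v = \sum_(i \in [set: I]) component i v].
Proof. by rewrite /component; case: cid => w [/= []]. Qed.

Lemma component_unique x (v : rep_space V x) (w : I -> rep_space V x) :
    (forall i, w i \in subrep_at (W i) x) -> finite_set [set i | w i != 0] ->
    v = \sum_(i \in [set: I]) w i ->
  forall i, component i v = w i.
Proof.
move=> Ww fin_w vE i; rewrite /component; case: cid => w' [/= _ uniq_w'].
by rewrite (uniq_w' w).
Qed.

Lemma component_is_linear i x : linear (@component i x).
Proof.
move=> c u v; have [Wu finu uE] := componentP u.
have [Wv finv vE] := componentP v.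
have finZ : finite_set [set i | c *: component i u != 0].
  apply: sub_finite_set finu => j /=.
  by apply: contra_neq => ->; rewrite scaler0.
apply: (component_unique (w := fun i => c *: component i u + component i v)).
- by move=> j; rewrite rpredD ?rpredZ.
- have : finite_set ([set i | c *: component i u != 0]
                      `|` [set i | component i v != 0]) by rewrite finite_setU.
  apply: sub_finite_set => j /= cj; apply: contrapT => /not_orP[].
  move=> /negP /negPn /eqP cu /negP /negPn /eqP cv.
  by rewrite cu cv addr0 eqxx in cj.
- rewrite fsumD // -(additive_fsum ( *:%R c)) //.
  by rewrite -uE -vE.
Qed.

HB.instance Definition _ i x := GRing.isLinear.Build F (rep_space V x)
  (rep_space V x) _ (@component i x) (@component_is_linear i x).

Lemma component_in i j x (v : rep_space V x) :
  v \in subrep_at (W j) x -> component i v = if i == j then v else 0.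
Proof.
move=> Wv; apply: (component_unique (w := fun i => if i == j then v else 0)).
- by move=> k; case: eqP => [->|_] //; rewrite rpred0.
- apply: sub_finite_set (finite_set1 j) => k /=.
  by case: (k =P j) => //; rewrite eqxx.
- by rewrite fsum_single.
Qed.

Definition component_endo i x :
  {linear rep_space V x -> rep_space V x} := @component i x.

(** Arrows map a decomposition of v to one of the image of v, so uniqueness makes
    the components commute with them. *)
Lemma component_endoP i : endomorphism (component_endo i).
Proof.
move=> a v; have [Wv finv vE] := componentP v.
apply: (component_unique (w := fun i => rep_map V a (component i v))).
- by move=> j; apply: subrep_stable.
- apply: sub_finite_set finv => j /=.
  by apply: contra_neq => ->; rewrite raddf0.
- by rewrite -additive_fsum // -vE.
Qed.

End Components.

(** * The representation by tails of sequences *)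

Section TailRep.
Variable F : fieldType.
Implicit Types x : vertex Omega.

(** This embeds the whole representation into the constant representation on the
    space of sequences: vectors at different vertices are compared through it,
    which avoids composing inclusions along paths. *)
Definition tail_seq x : rep_space (tail_rep F) x -> (nat -> F^o) :=
  match x with
  | Posz m => fun b => subspace_val b
  | Negz _ => fun=> 0
  end.

(* Unfolding would hide the linear structure of tail_seq from rewriting. *)
#[global] Arguments tail_seq : simpl never.

Lemma tail_seq_is_linear x : linear (@tail_seq x).
Proof. by case: x => m c u v //=; rewrite scaler0 addr0. Qed.

HB.instance Definition _ x := GRing.isLinear.Build F
  (rep_space (tail_rep F) x) (nat -> F^o) _ (@tail_seq x)
  (@tail_seq_is_linear x).

Lemma tail_seq_inj x : injective (@tail_seq x).
Proof.
case: x => m u v /= => [/val_inj //|_].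
by apply/rowP; case.
Qed.

Lemma tail_seq_map a (v : rep_space (tail_rep F) (source a)) :
  tail_seq (rep_map (tail_rep F) a v) = tail_seq v.
Proof. by case: a v => // m v; exact: raddf0. Qed.

Lemma tail_seq0 n (v : rep_space (tail_rep F) (Posz n)) m :
  (m < n)%N -> tail_seq v m = 0.
Proof. by have /asboolP := subspace_valP v; apply. Qed.

Lemma tail_vector n (b : nat -> F^o) : (forall m, (m < n)%N -> b m = 0) ->
  exists v : rep_space (tail_rep F) (Posz n), tail_seq v = b.
Proof.
move=> b0; have tb : b \in tail_subspace F n by apply/asboolP.
by exists (SubspaceType tb).
Qed.

(** An endomorphism commutes with the composite inclusion of V_n into V_m, so its
    effect on a sequence does not depend on the vertex. *)
Lemma endo_tail_seq (f : forall x, {linear rep_space (tail_rep F) x ->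
                                            rep_space (tail_rep F) x}) :
    endomorphism f ->
  forall m n (u : rep_space (tail_rep F) (Posz n))
             (v : rep_space (tail_rep F) (Posz m)),
    (m <= n)%N -> tail_seq u = tail_seq v ->
  tail_seq (f _ u) = tail_seq (f _ v).
Proof.
move=> ef m n u v /subnK; move: (n - m)%N => d nE.
case: n / nE u; elim: d => [u /tail_seq_inj -> //|d IHd u uv].
rewrite -(tail_seq_map (a := Posz (d + m))) -ef; apply: IHd.
by rewrite -uv; exact: (tail_seq_map (a := Posz (d + m))).
Qed.

Lemma subrep_tail_seq (W : subrepresentation (tail_rep F)) m n
    (u : rep_space (tail_rep F) (Posz n))
    (v : rep_space (tail_rep F) (Posz m)) :
    (m <= n)%N -> tail_seq u = tail_seq v ->
  u \in subrep_at W (Posz n) -> v \in subrep_at W (Posz m).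
Proof.
move=> /subnK; move: (n - m)%N => d nE.
case: n / nE u; elim: d => [u /tail_seq_inj -> //|d IHd u uv Wu].
apply: (IHd (rep_map (tail_rep F) (Posz (d + m)) u)).
  by rewrite -uv; exact: (tail_seq_map (a := Posz (d + m))).
exact: subrep_stable.
Qed.

(** The map u |-> (u_n / w_n) w is an idempotent endomorphism of W which fixes w
    and kills u; it cannot be 0, hence it is the identity, and u = 0. *)
Lemma indecomposable_subrep_leading (W : subrepresentation (tail_rep F)) n
    (w : rep_space (tail_rep F) (Posz n))
    (u : rep_space (tail_rep F) (Posz n.+1)) :
    indecomposable (rep_of_subrep W) ->
    w \in subrep_at W (Posz n) -> tail_seq w n != 0 ->
    u \in subrep_at W (Posz n.+1) ->
  u = 0.
Proof.
move=> indW Ww wn Wu.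
pose U := rep_of_subrep W.
pose useq x (v : rep_space U x) := tail_seq (val v).
have useq_inj x : injective (@useq x) by move=> v v' /tail_seq_inj /val_inj.
have useqP x c (v v' : rep_space U x) :
  useq x (c *: v + v') = c *: useq x v + useq x v' by exact: linearP.
have useq0 x : useq x 0 = 0 by exact: raddf0.
have useqZ x c (v : rep_space U x) : useq x (c *: v) = c *: useq x v.
  by exact: linearZ.
have useq_map a v : useq _ (rep_map U a v) = useq _ v by exact: tail_seq_map.
pose below x := if x is Posz k then (k <= n)%N else false.
have useq_above x (v : rep_space U x) : ~~ below x -> useq x v n = 0.
  by case: x v => k v //=; rewrite -ltnNge => nk; exact: tail_seq0.
have below_map a : below (source a) -> below (target a).
  by case: a => // k; exact: ltnW.
(* The vector w seen in W at x_k for 0 <= k <= n; there is no such vector beyond,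
   where 0 does as well because the n-th coordinates vanish. *)
have /all_sig[e eE] x :
    {e : rep_space U x | useq x e = if below x then tail_seq w else 0}.
  apply: cid; case: x => k /=; last by exists 0.
  case: leqP => kn; last by exists 0; exact: (useq0 (Posz k)).
  have [m mk|v vE] := @tail_vector k (tail_seq w).
    by rewrite tail_seq0 // (leq_trans mk).
  by exists (SubspaceType (subrep_tail_seq kn (esym vE) Ww)).
pose f x (v : rep_space U x) := (useq x v n / tail_seq w n) *: e x.
have f_lin x : linear (f x).
  by move=> c v v'; rewrite /f useqP scalerA -scalerDl mulrA -mulrDl.
pose fl x : {linear rep_space U x -> rep_space U x} :=
  HB.pack (f x) (GRing.isLinear.Build F _ _ _ (f x) (f_lin x)).
have flE x v : useq x (fl x v) =
    if below x then (useq x v n / tail_seq w n) *: tail_seq w else 0.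
  by rewrite /= /f useqZ eE; case: ifP => //; rewrite scaler0.
have f_endo : endomorphism fl.
  move=> a v; apply: useq_inj; rewrite useq_map !flE useq_map.
  have [sb|sb] := boolP (below (source a)); first by rewrite below_map.
  by rewrite useq_above // mul0r scale0r if_same.
have f_idem x v : fl x (fl x v) = fl x v.
  apply: useq_inj; rewrite !flE; case: (below x) => //.
  by congr (_ *: _); exact: mulfK.
case: (indecomposable_idempotent indW f_endo f_idem) => [f0|f1].
- have w0 : tail_seq w = 0.
    have := flE (Posz n) (SubspaceType Ww).
    by rewrite f0 useq0 /below leqnn divff // scale1r.
  by rewrite w0 eqxx in wn.
- have := flE (Posz n.+1) (SubspaceType Wu).
  rewrite f1 /below ltnn => u0; apply: (@tail_seq_inj (Posz n.+1)).
  by rewrite [RHS]raddf0; exact: u0.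
Qed.

(** The components of the n-th unit vector have n-th coordinates summing to 1, so
    they are not all zero. *)
Lemma leading_component (I : choiceType)
    (W : I -> subrepresentation (tail_rep F)) (dsW : is_direct_sum W) n :
  exists i, exists2 w : rep_space (tail_rep F) (Posz n),
    w \in subrep_at (W i) (Posz n) & tail_seq w n != 0.
Proof.
have [m mn|v vE] := @tail_vector n (fun k => (k == n)%:R).
  by rewrite (ltn_eqF mn).
apply: contrapT => noW.
have [Wv finv vsum] := componentP dsW v.
pose coord (u : rep_space (tail_rep F) (Posz n)) := tail_seq u n.
have coord_lin : linear_for *%R coord.
  by move=> c u u'; rewrite /coord linearP.
pose coordl : {scalar rep_space (tail_rep F) (Posz n)} :=
  HB.pack coord (GRing.isLinear.Build F _ _ _ coord coord_lin).
have v1 : coordl v = 1 by rewrite /= /coord vE eqxx.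
have /eqP[] := oner_neq0 F; rewrite -[LHS]v1 vsum additive_fsum //.
apply: fsbig1 => i _; apply: contrapT => /eqP cv; apply: noW.
by exists i, (component dsW i v).
Qed.

End TailRep.

Theorem corollary8p2 (F : fieldType) : ~ krull_schmidt (tail_rep F).
Proof.
move=> [I [W [indW dsW]]].
have /all_tag[i /all_sig2[w Ww wn]] n : {j : I &
    {u : rep_space (tail_rep F) (Posz n) |
      u \in subrep_at (W j) (Posz n) & tail_seq u n != 0}}.
  by have [j /cid2 u] := cid (leading_component dsW n); exists j.
have top n (u : rep_space (tail_rep F) (Posz n.+1)) :
    u \in subrep_at (W (i n)) (Posz n.+1) -> u = 0.
  exact: indecomposable_subrep_leading (indW (i n)) (Ww n) (wn n).
(* If i m = i n with m < n, then w n, seen at x_(m+1), is a nonzero vector of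
   W (i m), against top. *)
have i_neq m n : (m < n)%N -> i m != i n.
  move=> mn; apply/eqP => imn.
  have [k km|u uE] := @tail_vector F m.+1 (tail_seq (w n)).
    by rewrite tail_seq0 // (leq_trans km).
  have u0 : u = 0.
    by apply: top; rewrite imn; exact: subrep_tail_seq mn (esym uE) (Ww n).
  by have := wn n; rewrite -uE u0 raddf0 eqxx.
have i_inj : injective i.
  by move=> m n imn; case: (ltngtP m n) => // /i_neq; rewrite imn eqxx.
(* The sum of all the sequences w k: the terms with k > m vanish at m. *)
pose s m := (\sum_(k < m.+1) tail_seq (w k)) m.
have [//|v vE] := @tail_vector F 0 s.
have /choice[w0 w0E] n :
    exists u : rep_space (tail_rep F) (Posz 0), tail_seq u = tail_seq (w n).
  exact: tail_vector.
have Ww0 n : w0 n \in subrep_at (W (i n)) (Posz 0).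
  exact: subrep_tail_seq (leq0n n) (esym (w0E n)) (Ww n).
have comp_v n : component dsW (i n) v = w0 n.
  (* The remainder t starts after n, so it is also the sequence of a vector z at
     x_(n+1), where W (i n) is zero. *)
  pose t := s - \sum_(k < n.+1) tail_seq (w k).
  have [m mn|z zE] := @tail_vector F n.+1 t.
    rewrite /t -[LHS]/(s m - (\sum_(k < n.+1) tail_seq (w k)) m) /s !fct_sumE.
    rewrite (big_ord_widen n.+1 (fun k => tail_seq (w k) m)) // big_mkcond /=.
    apply/eqP; rewrite subr_eq0; apply/eqP/eq_bigr => k _.
    by case: leqP => // km; rewrite tail_seq0.
  have [//|z0 z0E] := @tail_vector F 0 t.
  have z_n : component dsW (i n) z = 0.
    by apply: top; case: (componentP dsW z).
  have z0_n : component dsW (i n) z0 = 0.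
    apply: (@tail_seq_inj F (Posz 0)); rewrite [RHS]raddf0.
    have /= <- := endo_tail_seq (component_endoP dsW (i n)) (leq0n n.+1)
                    (etrans zE (esym z0E)).
    by rewrite z_n raddf0.
  have -> : v = z0 + \sum_(k < n.+1) w0 k.
    apply: tail_seq_inj; rewrite vE raddfD raddf_sum /= z0E.
    by under eq_bigr do rewrite w0E; rewrite subrK.
  rewrite raddfD raddf_sum big_ord_recr /= (component_in _ _ (Ww0 n)) eqxx.
  rewrite big1 => [|k _].
    by rewrite add0r z0_n add0r.
  by rewrite (component_in _ _ (Ww0 k)) eq_sym (negPf (i_neq _ _ _)).
have [_ fin_v _] := componentP dsW v.
have fin_i : finite_set (i @^-1` [set j | component dsW j v != 0]).
  by apply: finite_preimage fin_v => m n _ _; exact: i_inj.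
apply: infinite_nat; apply: sub_finite_set fin_i => n _ /=.
by rewrite comp_v; apply: contra_neq (wn n) => w0n; rewrite -w0E w0n raddf0.
Qed.
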